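(* For the type $B$ Cauchy numbers of the first kind $C_n^B$, $$\sum_{n \geq 0} (-1)^{n-1} C_n^B\,\frac{x^n}{n!} = \frac{1-\sqrt{1-2x}}{\sqrt{1-2x}\;\ln\sqrt{1-2x}} .$$
   Context: The type $B$ falling factorial is $(x)_n^B = (x-1)(x-3)(x-5)\cdots(x-2n+1)$ for $n\ge 1$, with $(x)_0^B = 1$. The type $B$ Cauchy numbers of the first kind are $C_n^B = \int_0^1 (x)_n^B\,dx$ for $n\ge 0$. For $n=0$ the sign $(-1)^{n-1}$ equals $-1$. The identity is one of formal power series in $x$ with rational coefficients: $\sqrt{1-2x}$ and $\ln\sqrt{1-2x}=\tfrac12\ln(1-2x)$ denote the usual power series expansions at $x=0$; numerator and denominator both vanish to order exactly $1$ at $x=0$, and the quotient is understood as the resulting power series. *)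

(* Defs.v *)
From HB Require Import structures.
From mathcomp Require Import all_boot all_order all_algebra.
From mathcomp Require Import all_classical all_reals all_analysis.

Set Implicit Arguments.
Unset Strict Implicit.
Unset Printing Implicit Defensive.

Import Order.TTheory GRing.Theory Num.Theory.
Local Open Scope ring_scope.

(* A formal power series is wrapped in a record, so that its product is the
   Cauchy product and not the pointwise product of functions. *)
Record fps (R : Type) := Fps { coef_fps :> nat -> R }.

Notation "{ 'fps' R }" := (fps R) (format "{ 'fps'  R }") : type_scope.

Lemma fpsP (R : Type) (f g : {fps R}) : f =1 g <-> f = g.
Proof.
by case: f g => [f] [g]; split=> [/= /funext ->|[->]].
Qed.

HB.instance Definition _ (R : Type) := gen_eqMixin {fps R}.
HB.instance Definition _ (R : Type) := gen_choiceMixin {fps R}.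

Definition fpsC (R : nmodType) (a : R) : {fps R} :=
  Fps (fun n => if n == 0%N then a else 0).
Definition fps_add (R : nmodType) (f g : {fps R}) : {fps R} :=
  Fps (fun n => f n + g n).
Definition fps_opp (R : zmodType) (f : {fps R}) : {fps R} :=
  Fps (fun n => - f n).
Definition fps_mul (R : nzRingType) (f g : {fps R}) : {fps R} :=
  Fps (fun n => \sum_(i < n.+1) f i * g (n - i)%N).

Lemma fps_addA (R : zmodType) : associative (@fps_add R).
Proof. by move=> f g h; apply/fpsP => n /=; rewrite addrA. Qed.

Lemma fps_addC (R : zmodType) : commutative (@fps_add R).
Proof. by move=> f g; apply/fpsP => n /=; rewrite addrC. Qed.

Lemma fps_add0 (R : zmodType) : left_id (fpsC (0 : R)) (@fps_add R).
Proof. by move=> f; apply/fpsP => n /=; case: eqP; rewrite add0r. Qed.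

Lemma fps_addN (R : zmodType) :
  left_inverse (fpsC (0 : R)) (@fps_opp R) (@fps_add R).
Proof. by move=> f; apply/fpsP => n /=; case: eqP; rewrite addNr. Qed.

HB.instance Definition _ (R : zmodType) := GRing.isZmodule.Build {fps R}
  (@fps_addA R) (@fps_addC R) (@fps_add0 R) (@fps_addN R).

Lemma fps_mul_poly (R : nzRingType) (f g : {fps R}) (p q : {poly R}) (n : nat) :
    (forall k, (k <= n)%N -> p`_k = f k) ->
    (forall k, (k <= n)%N -> q`_k = g k) ->
  (p * q)`_n = fps_mul f g n.
Proof.
move=> pf qg; rewrite coefM /=; apply: eq_bigr => i _.
by rewrite pf ?qg ?leq_subr // -ltnS.
Qed.

Definition fps_trunc (R : nzRingType) (n : nat) (f : {fps R}) : {poly R} :=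
  \poly_(i < n.+1) f i.

Lemma coef_fps_trunc (R : nzRingType) (n k : nat) (f : {fps R}) :
  (k <= n)%N -> (fps_trunc n f)`_k = f k.
Proof. by move=> kn; rewrite coef_poly ltnS kn. Qed.

Lemma fps_mulA (R : comNzRingType) : associative (@fps_mul R).
Proof.
move=> f g h; apply/fpsP => n; pose t := @fps_trunc R n.
have tE f' k : (k <= n)%N -> (t f')`_k = f' k by exact: coef_fps_trunc.
have tM f1 g1 k : (k <= n)%N -> (t f1 * t g1)`_k = fps_mul f1 g1 k.
  by move=> kn; apply: fps_mul_poly => j jk; apply: tE; apply: leq_trans kn.
rewrite -(@fps_mul_poly _ f (fps_mul g h) (t f) (t g * t h)) //; last 2 first.
- by move=> k; exact: tE.
- by move=> k; exact: tM.
rewrite -(@fps_mul_poly _ (fps_mul f g) h (t f * t g) (t h)) ?mulrA //.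
- by move=> k; exact: tM.
- by move=> k; exact: tE.
Qed.

Lemma fps_mulC (R : comNzRingType) : commutative (@fps_mul R).
Proof.
move=> f g; apply/fpsP => n.
rewrite -(@fps_mul_poly _ f g (fps_trunc n f) (fps_trunc n g)); last 2 first.
- by move=> k; exact: coef_fps_trunc.
- by move=> k; exact: coef_fps_trunc.
by rewrite mulrC; apply: fps_mul_poly => k; exact: coef_fps_trunc.
Qed.

Lemma fps_mul1 (R : comNzRingType) : left_id (fpsC (1 : R)) (@fps_mul R).
Proof.
move=> f; apply/fpsP => n /=; rewrite big_ord_recl /= mul1r subn0 big1 ?addr0 //.
by move=> i _; rewrite mul0r.
Qed.

Lemma fps_mulDl (R : comNzRingType) :
  left_distributive (@fps_mul R) (@fps_add R).
Proof.
move=> f g h; apply/fpsP => n /=; rewrite -big_split /=.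
by apply: eq_bigr => i _; rewrite mulrDl.
Qed.

Lemma fps_oner_neq0 (R : comNzRingType) : fpsC (1 : R) != 0.
Proof. by apply/eqP => /fpsP/(_ 0%N)/eqP; rewrite /= oner_eq0. Qed.

HB.instance Definition _ (R : comNzRingType) :=
  GRing.Zmodule_isComNzRing.Build {fps R} (@fps_mulA R) (@fps_mulC R)
    (@fps_mul1 R) (@fps_mulDl R) (@fps_oner_neq0 R).

Lemma coef_fps0 (R : zmodType) n : (0 : {fps R}) n = 0.
Proof. by rewrite [LHS]/=; case: eqP. Qed.

Lemma coef_fps1 (R : comNzRingType) n : (1 : {fps R}) n = (n == 0%N)%:R.
Proof. by rewrite [LHS]/=; case: eqP. Qed.

Lemma coef_fpsD (R : zmodType) (f g : {fps R}) n : (f + g) n = f n + g n.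
Proof. by []. Qed.

Lemma coef_fpsN (R : zmodType) (f : {fps R}) n : (- f) n = - f n.
Proof. by []. Qed.

Lemma coef_fpsM (R : comNzRingType) (f g : {fps R}) n :
  (f * g) n = \sum_(i < n.+1) f i * g (n - i)%N.
Proof. by []. Qed.

Definition fps_unit (R : comNzRingType) : {pred {fps R}} :=
  fun f => `[< exists g, g * f = 1 >].
Definition fps_inv (R : comNzRingType) (f : {fps R}) : {fps R} :=
  xget f [set g | g * f = 1]%classic.

Lemma fps_mulVf (R : comNzRingType) :
  {in @fps_unit R, left_inverse 1 (@fps_inv R) *%R}.
Proof. by move=> f /asboolP [g gf]; rewrite /fps_inv; case: xgetP => // /(_ g). Qed.

Lemma fps_unitPl (R : comNzRingType) (f g : {fps R}) :
  g * f = 1 -> fps_unit f.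
Proof. by move=> gf; apply/asboolP; exists g. Qed.

Lemma fps_invr_out (R : comNzRingType) :
  {in [predC @fps_unit R], @fps_inv R =1 id}.
Proof.
move=> f /negP fU; rewrite /fps_inv; case: xgetP => // g _ gf.
by case: fU; exact: fps_unitPl gf.
Qed.

HB.instance Definition _ (R : comNzRingType) :=
  GRing.ComNzRing_hasMulInverse.Build {fps R} (@fps_mulVf R) (@fps_unitPl R)
    (@fps_invr_out R).

Lemma fps_order (R : zmodType) (f : {fps R}) : f != 0 ->
  exists2 n, f n != 0 & forall k, (k < n)%N -> f k = 0.
Proof.
move=> f0; have /ex_minnP[n fn minn] : exists n, f n != 0.
  apply: contrapT => nf; move/eqP: f0; apply; apply/fpsP => n.
  rewrite coef_fps0; apply/eqP; apply: contrapT => /negP fn.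
  by apply: nf; exists n.
exists n => // k; apply: contraTeq => fk; rewrite -leqNgt; exact: minn.
Qed.

Lemma fps_integral (R : idomainType) (f g : {fps R}) :
  f * g = 0 -> (f == 0) || (g == 0).
Proof.
move=> fg0; apply: contrapT => /negP; rewrite negb_or => /andP[].
move=> /fps_order[m fm minm] /fps_order[n gn minn].
have := coef_fpsM f g (m + n); rewrite fg0 coef_fps0 => /esym/eqP.
have mP : (m < (m + n).+1)%N by rewrite ltnS leq_addr.
rewrite (bigD1 (Ordinal mP)) //= addKn big1 => [|i /eqP im].
  by rewrite addr0 mulf_eq0 (negbTE fm) (negbTE gn).
case: (ltngtP i m) => [im'|mi|im'].
- by rewrite minm // mul0r.
- by rewrite [g _]minn ?mulr0 // ltn_subLR ?ltn_add2r // -ltnS; exact: ltn_ord.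
- by case: im; apply/val_inj.
Qed.

HB.instance Definition _ (R : idomainType) :=
  GRing.ComUnitRing_isIntegral.Build {fps R} (@fps_integral R).

Definition map_fps (R S : Type) (h : R -> S) (f : {fps R}) : {fps S} :=
  Fps (fun n => h (f n)).

Definition gbinom (F : fieldType) (a : F) (n : nat) : F :=
  (\prod_(i < n) (a - i%:R)) / n`!%:R.

(* Binomial series of (1 + u)^(1/2) at u = - 2x. *)
Definition fps_sqrt12X : {fps rat} :=
  Fps (fun n => gbinom (2^-1 : rat) n * (- 2) ^+ n).

(* ln(1 - u) = - \sum_(n >= 1) u^n / n at u = 2x. *)
Definition fps_ln12X : {fps rat} :=
  Fps (fun n => if n == 0%N then 0 else - (2 ^+ n / n%:R)).

Definition fps_lnsqrt12X : {fps rat} := fpsC (2^-1 : rat) * fps_ln12X.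

(* Sanity check: the denominator in the generating function is not 0, so that
   its inverse in the field of fractions is a genuine one. *)
Lemma fps_denom_order1 :
  (fps_sqrt12X * fps_lnsqrt12X) 0%N = 0 /\
  (fps_sqrt12X * fps_lnsqrt12X) 1%N = -1.
Proof.
have l0 : fps_lnsqrt12X 0%N = 0 by rewrite coef_fpsM big_ord1 mulr0.
have l1 : fps_lnsqrt12X 1%N = -1.
  rewrite coef_fpsM big_ord_recl big_ord1 /=.
  by rewrite mul0r addr0 expr1 divr1 mulrN mulVf.
move: fps_lnsqrt12X l0 l1 => l l0 l1.
split; first by rewrite coef_fpsM big_ord1 l0 mulr0.
rewrite coef_fpsM big_ord_recl big_ord1 /= l0 l1 mulr0.
by rewrite /gbinom big_ord0 fact0 expr0 divr1 !mul1r addr0.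
Qed.

Lemma fps_denom_neq0 : fps_sqrt12X * fps_lnsqrt12X != 0.
Proof.
apply/eqP => d0; have [_] := fps_denom_order1.
by rewrite d0 coef_fps0.
Qed.

(* The truncated subtraction 2 * k - 1 is a genuine one since k >= 1. *)
Definition ffactB (R : nzRingType) (x : R) (n : nat) : R :=
  \prod_(1 <= k < n.+1) (x - (2 * k - 1)%:R).

Definition cauchyB (R : realType) (n : nat) : R :=
  \int[lebesgue_measure]_(x in `[0, 1]%classic) ffactB x n.

(* Main.v *)
Require Import Defs.
From HB Require Import structures.
From mathcomp Require Import all_boot all_order all_algebra.
From mathcomp Require Import all_classical all_reals all_analysis.
From mathcomp Require Import ring.

Set Implicit Arguments.
Unset Strict Implicit.
Unset Printing Implicit Defensive.

Import Order.TTheory GRing.Theory Num.Theory.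
Import numFieldNormedType.Exports.
Local Open Scope ring_scope.

(** The generating function of the polynomials
    (-1)^n (t)_n^B / n! = (-2)^n binom((t-1)/2, n)
    is, by the binomial series, G_t = (1 - 2x)^((t-1)/2).  Analytically
    d/dt G_t = ln(sqrt(1 - 2x)) G_t, so integrating over t in [0, 1] gives
    ln(sqrt(1 - 2x)) * (int_0^1 G_t dt) = G_1 - G_0 = 1 - 1/sqrt(1 - 2x),
    and the theorem follows after multiplying by -sqrt(1 - 2x).

    Everything is done with formal power series, of which G_t ([binomB]) is
    one with coefficients in any commutative ring containing the inverses of
    the positive integers: the rationals for a numerical t, and the rational
    polynomials for an indeterminate t.  The exponential and logarithm laws
    are replaced by a differential equation: with the derivation
    D = (1 - 2x) d/dx ([bderiv]), one has D G_t = (1 - t) G_t and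
    D ln(sqrt(1 - 2x)) = -1, and a solution of D f = c f is determined by its
    constant term ([bderiv_eq0]).  This uniqueness yields both G_2 G_0 = G_1,
    where G_2 = sqrt(1 - 2x) and G_1 = 1 ([binomBM]), and the formula for the
    derivative in t ([deriv_binomB]).

    The integral over t is the rational linear form [int01] on polynomials,
    applied to each coefficient; on polynomials it agrees with the Lebesgue
    integral by the fundamental theorem of calculus ([Rintegral_poly]). *)

(** * The derivation (1 - 2x) d/dx on power series *)

Section BDeriv.
Context (K : comUnitRingType).
Implicit Types f g : {fps K}.

Definition fps_euler f : {fps K} := Fps (fun n => f n *+ n).
Definition fps_deriv f : {fps K} := Fps (fun n => f n.+1 *+ n.+1).

(** This is (1 - 2x) d/dx: writing it as d/dx - 2 (x d/dx) makes it a
    combination of two derivations that act on coefficients. *)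
Definition bderiv f : {fps K} := fps_deriv f - fps_euler f *+ 2.

(** The Euler operator x d/dx multiplies the coefficient of x^n by n, so the
    Leibniz rule is the splitting n = i + (n - i) in the Cauchy product. *)
Lemma fps_eulerM f g :
  fps_euler (f * g) = fps_euler f * g + f * fps_euler g.
Proof.
apply/fpsP => n; rewrite coef_fpsD !coef_fpsM /= -big_split -sumrMnl.
apply: eq_bigr => i _ /=.
by rewrite mulrnAl mulrnAr -mulrnDr subnKC // -ltnS.
Qed.

(** The derivative is the Euler operator shifted by one coefficient. *)
Lemma fps_derivM f g :
  fps_deriv (f * g) = fps_deriv f * g + f * fps_deriv g.
Proof.
apply/fpsP => n; have := congr1 (fun h : {fps K} => h n.+1) (fps_eulerM f g).
rewrite !coef_fpsD /= => ->; congr (_ + _).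
  by rewrite big_ord_recl /= mulr0n mul0r add0r.
rewrite big_ord_recr /= subnn mulr0n mulr0 addr0.
by apply: eq_bigr => i _; rewrite subSn // -ltnS.
Qed.

Lemma bderivM f g : bderiv (f * g) = bderiv f * g + f * bderiv g.
Proof. rewrite /bderiv fps_eulerM fps_derivM; ring. Qed.

Lemma coef_bderiv f n : bderiv f n = f n.+1 *+ n.+1 - f n *+ (2 * n).
Proof. by rewrite coef_fpsD coef_fpsN mulr2n coef_fpsD /= mul2n -addnn mulrnDr. Qed.

Lemma bderivB f g : bderiv (f - g) = bderiv f - bderiv g.
Proof.
apply/fpsP => n; rewrite [RHS]coef_fpsD [X in _ = _ + X]coef_fpsN.
by rewrite !coef_bderiv /= !mulrnBl; ring.
Qed.

Lemma coef_fpsCM (a : K) f n : (fpsC a * f) n = a * f n.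
Proof.
rewrite coef_fpsM big_ord_recl /= subn0 big1 ?addr0 // => i _.
by rewrite mul0r.
Qed.

Context (natU : forall n, (n.+1%:R : K) \is a GRing.unit).

(** At x^n the equation D f = c f reads (n + 1) f_(n+1) = (c + 2 n) f_n, so the
    vanishing of f_0 propagates to every coefficient. *)
Lemma bderiv_eq0 (c : K) f : f 0%N = 0 -> bderiv f = fpsC c * f -> f = 0.
Proof.
move=> f0 fE; apply/fpsP => n; rewrite coef_fps0; elim: n => // n fn0.
have := congr1 (fun h : {fps K} => h n) fE.
rewrite coef_bderiv coef_fpsCM fn0 mul0rn mulr0 subr0 -mulr_natl => nf.
by apply: (mulrI (natU n)); rewrite nf mulr0.
Qed.

(** * The binomial series (1 - 2x)^((t-1)/2) *)

(** By the binomial series this is (1 - 2x)^((t-1)/2), since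
    (t)_n^B = 2^n ((t-1)/2) ((t-1)/2 - 1) ... ((t-1)/2 - n + 1). *)
Definition binomB (t : K) : {fps K} :=
  Fps (fun n => (-1) ^+ n * (ffactB t n / n`!%:R)).

Lemma ffactBS (t : K) n : ffactB t n.+1 = ffactB t n * (t - (2 * n + 1)%:R).
Proof. by rewrite /ffactB big_nat_recr //= mulnSr -addnBA. Qed.

Lemma binomB0 t : binomB t 0%N = 1.
Proof. by rewrite /= /ffactB big_nil fact0 divr1 mulr1. Qed.

Lemma binomBS t n :
  binomB t n.+1 *+ n.+1 = binomB t n * (1 - t + (2 * n)%:R).
Proof.
have fU : (n`!%:R : K) \is a GRing.unit by case: (n`!) (fact_gt0 n).
rewrite /= ffactBS factS natrM invrM // exprS -mulr_natl.
set m : K := n.+1%:R; set a := ffactB t n.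
have mV : m * m^-1 = 1 by rewrite mulrV ?natU.
transitivity ((m * m^-1) * ((-1) ^+ n * (a / n`!%:R) * (1 - t + (2 * n)%:R))).
  by rewrite natrD; ring.
by rewrite mV mul1r.
Qed.

Lemma bderiv_binomB t : bderiv (binomB t) = fpsC (1 - t) * binomB t.
Proof.
apply/fpsP => n; rewrite coef_bderiv coef_fpsCM binomBS -[_ *+ (2 * n)]mulr_natr.
by ring.
Qed.

(** The exponents satisfy (s-1)/2 + (t-1)/2 = (u-1)/2 when s + t = u + 1; both
    sides solve D f = (1 - u) f with constant term 1. *)
Lemma binomBM s t u : s + t = u + 1 -> binomB s * binomB t = binomB u.
Proof.
move=> stu; apply/eqP; rewrite -subr_eq0; apply/eqP.
apply: (@bderiv_eq0 (1 - u)).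
  rewrite coef_fpsD coef_fpsN coef_fpsM big_ord1 subn0 !binomB0; ring.
rewrite bderivB bderivM !bderiv_binomB.
have -> : fpsC (1 - u) = fpsC (1 - s) + fpsC (1 - t).
  have -> : u = s + t - 1 by rewrite stu addrK.
  by apply/fpsP => n; rewrite coef_fpsD /=; case: eqP => _; ring.
by rewrite mulrBr mulrDl !mulrA [binomB s * _]mulrC; ring.
Qed.

End BDeriv.

Lemma polyrat_natU n : (n.+1%:R : {poly rat}) \is a GRing.unit.
Proof. by rewrite -(rmorph_nat polyC) rmorph_unit // unitfE pnatr_eq0. Qed.

Lemma rat_natU n : (n.+1%:R : rat) \is a GRing.unit.
Proof. by rewrite unitfE pnatr_eq0. Qed.

(** * Integration of polynomials over [0, 1] *)

Section PolyInt.
Context (F : numFieldType).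
Implicit Types p q : {poly F}.

(** The constant coefficient is p`_0 / 0 = 0, by the convention on division. *)
Definition poly_prim (p : {poly F}) : {poly F} :=
  \poly_(i < (size p).+1) (p`_i.-1 / i%:R).

Lemma coef_poly_prim p i : (poly_prim p)`_i = p`_i.-1 / i%:R.
Proof.
rewrite coef_poly; case: ltnP => //; case: i => // i pi.
by rewrite nth_default ?mul0r.
Qed.

Lemma poly_prim_deriv p : poly_prim p^`() = p - (p`_0)%:P.
Proof.
apply/polyP => -[|i]; rewrite coef_poly_prim coefB coefC /= ?subrr ?invr0 ?mulr0 //.
by rewrite coef_deriv subr0 -[p`_i.+1 *+ _]mulr_natr mulfK // pnatr_eq0.
Qed.

Lemma deriv_poly_prim p : (poly_prim p)^`() = p.
Proof.
apply/polyP => i; rewrite coef_deriv coef_poly_prim -[_ *+ i.+1]mulr_natr /=.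
by rewrite divfK // pnatr_eq0.
Qed.

Fact poly_prim_is_linear : linear poly_prim.
Proof.
move=> a p q; apply/polyP => i.
by rewrite coefD coefZ !coef_poly_prim coefD coefZ mulrDl mulrA.
Qed.

Definition int01 (p : {poly F}) : F := (poly_prim p).[1].

Fact int01_is_linear : scalar int01.
Proof. by move=> a p q; rewrite /int01 poly_prim_is_linear hornerD hornerZ. Qed.

HB.instance Definition _ :=
  GRing.isLinear.Build F {poly F} F *%R int01 int01_is_linear.

Lemma int01_deriv p : int01 p^`() = p.[1] - p.[0].
Proof.
by rewrite /int01 poly_prim_deriv hornerD hornerN hornerC horner_coef0.
Qed.

End PolyInt.

Lemma int01_map (F L : numFieldType) (h : {rmorphism F -> L}) (p : {poly F}) :
  int01 (map_poly h p) = h (int01 p).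
Proof.
rewrite /int01 -(rmorph1 h) -horner_map; congr (_.[_]); apply/polyP => i.
by rewrite coef_map !coef_poly_prim coef_map /= rmorphM fmorphV rmorph_nat.
Qed.

Lemma Rintegral_poly (R : realType) (p : {poly R}) :
  \int[lebesgue_measure]_(x in `[0, 1]%classic) p.[x] = int01 p.
Proof.
rewrite /Rintegral (@continuous_FTC2 R (horner p) (horner (poly_prim p))) //.
- by rewrite /= [X in _ - X]horner_coef0 coef_poly_prim invr0 mulr0 subr0.
- by apply: continuous_subspaceT => x; exact: continuous_horner.
- split; first by move=> x _; exact: derivable_horner.
  + by apply: cvg_at_right_filter; exact: continuous_horner.
  + by apply: cvg_at_left_filter; exact: continuous_horner.
- by move=> x _; rewrite -derivE deriv_poly_prim.
Qed.

(** * The coefficients of the binomial series as polynomials in t *)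

Lemma ffactB_map (K L : nzRingType) (h : {rmorphism K -> L}) (t : K) n :
  h (ffactB t n) = ffactB (h t) n.
Proof.
by rewrite rmorph_prod; apply: eq_bigr => k _; rewrite rmorphB rmorph_nat.
Qed.

Lemma ffactB_horner (K : comNzRingType) (p : {poly K}) x n :
  (ffactB p n).[x] = ffactB p.[x] n.
Proof.
rewrite horner_prod; apply: eq_bigr => k _.
by rewrite hornerD hornerN -(rmorph_nat polyC) hornerC.
Qed.

Lemma cauchyB_rat (R : realType) n : cauchyB R n = ratr (int01 (ffactB 'X n)).
Proof.
rewrite -int01_map -Rintegral_poly /cauchyB; congr Rintegral; apply/funext => x.
by rewrite ffactB_map ffactB_horner /= map_polyX hornerX.
Qed.

Lemma binomB1 : binomB (1 : rat) = 1.
Proof.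
apply/fpsP => -[|n]; first by rewrite binomB0.
rewrite coef_fps1 /= /ffactB big_nat_recl // muln1 subrr.
by rewrite !mul0r mulr0.
Qed.

Lemma binomB_ffact n :
  binomB 'X n = ((-1) ^+ n / n`!%:R) *: ffactB 'X n :> {poly rat}.
Proof.
rewrite -mul_polyC rmorphM rmorph_sign rmorphV ?unitfE ?pnatr_eq0 -?lt0n ?fact_gt0 //.
by rewrite rmorph_nat /=; ring.
Qed.

Lemma binomB_horner (x : rat) n : (binomB 'X n).[x] = binomB x n.
Proof. by rewrite binomB_ffact hornerZ ffactB_horner hornerX /=; ring. Qed.

(** The exponent (t-1)/2 is 1/2 for t = 2. *)
Lemma sqrt12X_binomB : fps_sqrt12X = binomB (2 : rat).
Proof.
apply/fpsP => n /=; rewrite /gbinom.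
rewrite mulrAC mulrA; congr (_ / _).
elim: n => [|n IHn]; first by rewrite big_ord0 /ffactB big_nil.
rewrite big_ord_recr ffactBS !exprS /=.
transitivity (\prod_(i < n) (2^-1 - i%:R) * (- 2) ^+ n * ((2^-1 - n%:R) * -2) : rat).
  by ring.
by rewrite IHn natrD natrM; field.
Qed.

(** * The logarithm as the derivative in the exponent *)

(** Series in x whose coefficients are constant in t. *)
Definition fps_polyC (f : {fps rat}) : {fps {poly rat}} := map_fps polyC f.

Lemma coef_fps_polyC f n : fps_polyC f n = (f n)%:P.
Proof. by []. Qed.

Lemma lnsqrt12X0 : fps_lnsqrt12X 0%N = 0.
Proof. by rewrite coef_fpsCM mulr0. Qed.

Lemma lnsqrt12XS n : fps_lnsqrt12X n.+1 *+ n.+1 = - 2 ^+ n.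
Proof.
rewrite coef_fpsCM /= exprS -mulr_natr; set a : rat := n.+1%:R.
have a0 : a != 0 by rewrite pnatr_eq0.
by field.
Qed.

Lemma bderiv_lnsqrt12X : bderiv (fps_polyC fps_lnsqrt12X) = -1.
Proof.
apply/fpsP => n; rewrite coef_bderiv [RHS]coef_fpsN coef_fps1 !coef_fps_polyC.
rewrite -!rmorphMn lnsqrt12XS mulnC mulrnA.
case: n => [|n]; first by rewrite mulr0n mul0rn rmorph0 subr0 rmorphN1.
rewrite lnsqrt12XS -rmorphB exprS mulr2n.
have -> : - (2 * 2 ^+ n) - (- 2 ^+ n - 2 ^+ n) = 0 :> rat by ring.
by rewrite mulr0n !rmorph0 oppr0.
Qed.

(** On series in x over the polynomials in t, this is d/dt. *)
Definition map_deriv (f : {fps {poly rat}}) := map_fps (fun p => p^`()) f.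

Lemma coef_map_deriv f n : map_deriv f n = (f n)^`().
Proof. by []. Qed.

(** This is d/dt (1 - 2x)^((t-1)/2) = ln(sqrt(1 - 2x)) (1 - 2x)^((t-1)/2).
    Differentiating D G = (1 - t) G in t gives
    D (dG/dt) = (1 - t) dG/dt - G, and ln(sqrt(1 - 2x)) G solves the same
    equation because D ln(sqrt(1 - 2x)) = -1; the difference has constant term
    0 and solves D f = (1 - t) f, so it vanishes. *)
Lemma deriv_binomB :
  map_deriv (binomB 'X) = fps_polyC fps_lnsqrt12X * binomB 'X.
Proof.
apply/eqP; rewrite -subr_eq0; apply/eqP.
apply: (bderiv_eq0 polyrat_natU (c := 1 - 'X)).
  rewrite coef_fpsD coef_fpsN coef_fpsM big_ord1 subn0 binomB0 mulr1.
  by rewrite coef_map_deriv binomB0 coef_fps_polyC lnsqrt12X0 derivC rmorph0 subrr.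
rewrite bderivB bderivM bderiv_lnsqrt12X bderiv_binomB; last exact: polyrat_natU.
have -> : bderiv (map_deriv (binomB 'X)) =
    fpsC (1 - 'X) * map_deriv (binomB 'X) - binomB 'X.
  apply/fpsP => n; rewrite coef_bderiv coef_fpsD coef_fpsN coef_fpsCM.
  rewrite !coef_map_deriv.
  rewrite -!derivMn -derivB -coef_bderiv (bderiv_binomB polyrat_natU) coef_fpsCM.
  by rewrite derivM derivB derivX -(rmorph1 polyC) derivC; ring.
by ring.
Qed.

(** The series of int_0^1 (1 - 2x)^((t-1)/2) dt, integrated coefficientwise. *)
Definition binomB_int01 : {fps rat} := map_fps (@int01 rat) (binomB 'X).

(** Integrating [deriv_binomB] over t in [0, 1]: the left-hand side becomes
    G_1 - G_0, and the logarithm, constant in t, comes out of the integral. *)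
Lemma lnsqrt12X_int01 : fps_lnsqrt12X * binomB_int01 = 1 - binomB 0.
Proof.
apply/fpsP => n; rewrite coef_fpsD coef_fpsN.
have : map_deriv (binomB 'X) n = (fps_polyC fps_lnsqrt12X * binomB 'X) n.
  by rewrite deriv_binomB.
move=> /(congr1 (@int01 rat)).
rewrite coef_map_deriv coef_fpsM linear_sum int01_deriv => e.
transitivity (\sum_(i < n.+1)
    int01 (fps_polyC fps_lnsqrt12X i * binomB 'X (n - i)%N)).
  by apply: eq_bigr => i _; rewrite coef_fps_polyC mul_polyC linearZ.
by rewrite -e -binomB1 !binomB_horner.
Qed.

Theorem theorem2p8 (R : realType) :
  exists F : {fps rat},
    map_fps (@ratr R) F =
      Fps (fun n : nat => (-1) ^ (n%:Z - 1) * (cauchyB R n / n`!%:R)) /\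
    tofrac F = tofrac (1 - fps_sqrt12X) / tofrac (fps_sqrt12X * fps_lnsqrt12X).
Proof.
exists (- binomB_int01); split.
  apply/fpsP => n; rewrite [RHS]/= cauchyB_rat.
  rewrite -[LHS]/(ratr (- int01 (binomB 'X n))).
  rewrite binomB_ffact linearZ /= rmorphN !rmorphM fmorphV rmorph_sign rmorph_nat.
  rewrite expfzDr ?oppr_eq0 ?oner_eq0 //.
  by rewrite -exprnP exprN1 invrN1; ring.
have d0 := fps_denom_neq0.
(* The quotient is cleared: what remains is the identity
   F * (sqrt * lnsqrt) = 1 - sqrt between power series. *)
apply: (canRL (mulfK _)); first by rewrite tofrac_eq0.
rewrite -tofracM; congr tofrac.
have SG : fps_sqrt12X * binomB 0 = 1.
  (* G_2 * G_0 = G_1, because 2 + 0 = 1 + 1. *)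
  rewrite sqrt12X_binomB -binomB1.
  by apply: (binomBM rat_natU); ring.
transitivity (fps_sqrt12X * binomB 0 - fps_sqrt12X); last by rewrite SG.
rewrite mulrC mulrN -mulrA lnsqrt12X_int01; ring.
Qed.
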